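(* Let $(A,\mu_k,\alpha)$ be an $HA_\infty$-algebra with $H^3_\alpha(A,A)=0$. Then for every $n\ge1$, every deformation of $A$ of order $n$ can be extended to a deformation of order $n+1$.
   Context: All vector spaces are over a field of characteristic zero; the Koszul sign rule is used; $\alpha$ is assumed not identically zero. $HA_\infty$-algebra $(A,\mu_k,\alpha)$: a graded vector space $A$ with linear maps $\mu_k:A^{\otimes k}\to A$ of degree $k-2$ ($k\ge1$) and a degree $0$ linear map $\alpha$ with $\alpha\circ\mu_k=\mu_k\circ\alpha^{\otimes k}$, such that for all $N\ge1$ $$\sum_{r+s+t=N,\ r,t\ge0,\ s\ge1}(-1)^{rs+t}\,\mu_{r+1+t}\big((\alpha^{s-1})^{\otimes r}\otimes\mu_s\otimes(\alpha^{s-1})^{\otimes t}\big)=0 .$$ Let $V=sA$, $(sA)_i=A_{i-1}$, with induced $\alpha:V\to V$. For a homogeneous $\varrho:V^{\otimes m}\to V$ with $\alpha\circ\varrho=\varrho\circ\alpha^{\otimes m}$, $\widetilde\varrho:TV\to TV$ ($TV=\oplus_{k\ge0}V^{\otimes k}$) is $0$ on $V^{\otimes k}$ for $k<m$ and, for $k\ge m$, $\widetilde\varrho(v_1\otimes\cdots\otimes v_k)=\sum_{i=0}^{k-m}(-1)^{|\varrho|(|v_1|+\cdots+|v_i|)}\alpha^{m-1}v_1\otimes\cdots\otimes\alpha^{m-1}v_i\otimes\varrho(v_{i+1}\otimes\cdots\otimes v_{i+m})\otimes\alpha^{m-1}v_{i+m+1}\otimes\cdots\otimes\alpha^{m-1}v_k$.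 $\mathrm{Coder}^p_\alpha(TV)$ is the space of all $\sum_{m\ge1}\widetilde{\varrho_m}$ with each $\varrho_m:V^{\otimes m}\to V$ of degree $p$ and $\alpha\circ\varrho_m=\varrho_m\circ\alpha^{\otimes m}$. It is a graded Lie algebra under the graded commutator of compositions $[E,E']=E\circ E'-(-1)^{pp'}E'\circ E$. The $HA_\infty$-structure corresponds to $D=\sum_{k\ge1}\widetilde{\varrho_k}\in\mathrm{Coder}^{-1}_\alpha(TV)$, $\varrho_k=s\circ\mu_k\circ(s^{-1})^{\otimes k}$, which satisfies $D\circ D=0$. Hochschild complex: $C^p_\alpha(A,A)=\mathrm{Coder}^{-(p-1)}_\alpha(TV)$, $\delta_\alpha=[D,-]$, cohomology $H^\bullet_\alpha(A,A)$. A deformation of order $n$ is $D_t=D+\sum_{i=1}^nt^iD_i$ with $D_i\in\mathrm{Coder}^{-1}_\alpha(TV)$ and $D_t\circ D_t=0$ modulo $t^{n+1}$, i.e. (with $D_0=D$) $\sum_{i+j=l}D_i\circ D_j=0$ for $0\le l\le n$. It extends to a deformation of order $n+1$ if there is $D_{n+1}\in\mathrm{Coder}^{-1}_\alpha(TV)$ such that $D_t+t^{n+1}D_{n+1}$ is a deformation of order $n+1$. *)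

(* Defs.v *)
From HB Require Import structures.
From mathcomp Require Import all_boot all_order all_algebra.
From mathcomp Require Import generic_quotient ring_quotient.
From mathcomp Require Import finmap monalg.
From mathcomp Require Import boolp.

Set Implicit Arguments.
Unset Strict Implicit.
Unset Printing Implicit Defensive.

Import GRing.Theory.

Local Open Scope ring_scope.
Local Open Scope quotient_scope.

Section TensorAlgebra.

Variables (K : fieldType) (V : lmodType K).

(* TV is the free vector space on words in V modulo linearity in each letter.
   The word [:: v1; ..; vk] stands for v1 (x) .. (x) vk. *)
Inductive tensor_rel : {malg K[seq V]} -> Prop :=
| TensorRel0 : tensor_rel 0
| TensorRelP a x y : tensor_rel x -> tensor_rel y -> tensor_rel (a *: x + y)
| TensorRelL u w a x y :
    tensor_rel (<< u ++ (a *: x + y) :: w >>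
                - (a *: << u ++ x :: w >> + << u ++ y :: w >>)).

Definition tensor_relb : {pred {malg K[seq V]}} := fun x => `[< tensor_rel x >].

Fact tensor_relb_zmod : zmod_closed tensor_relb.
Proof.
split=> [|x y]; first exact/asboolP/TensorRel0.
move=> /asboolP hx /asboolP hy; apply/asboolP.
by rewrite addrC -scaleN1r; apply: TensorRelP.
Qed.

HB.instance Definition _ :=
  GRing.isZmodClosed.Build {malg K[seq V]} tensor_relb tensor_relb_zmod.

Definition tensor_alg : Type := Quotient.quot tensor_relb.
HB.instance Definition _ := GRing.Zmodule.on tensor_alg.

Definition tensor_pi (x : {malg K[seq V]}) : tensor_alg :=
  \pi_(Quotient.quot tensor_relb) x.

Definition tensor_repr (x : tensor_alg) : {malg K[seq V]} :=
  repr (x : Quotient.quot tensor_relb).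

Fact tensor_reprK x : tensor_pi (tensor_repr x) = x.
Proof. exact: reprK. Qed.

Fact tensor_piP x y : tensor_pi x = tensor_pi y <-> tensor_rel (x - y).
Proof.
split=> [/eqP|h]; first by rewrite -Quotient.idealrBE => /asboolP.
by apply/eqP; rewrite -Quotient.idealrBE; apply/asboolP.
Qed.

Fact tensor_piD x y : tensor_pi (x + y) = tensor_pi x + tensor_pi y.
Proof. exact: (raddfD (\pi_(Quotient.quot tensor_relb))). Qed.

Definition tensor_scale (a : K) (x : tensor_alg) : tensor_alg :=
  tensor_pi (a *: tensor_repr x).

Fact tensor_piZ a x : tensor_pi (a *: x) = tensor_scale a (tensor_pi x).
Proof.
apply/tensor_piP; rewrite -scalerBr -[_ *: _]addr0.
apply: TensorRelP; last exact: TensorRel0.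
by apply/tensor_piP; rewrite tensor_reprK.
Qed.

Fact tensor_scaleA a b x :
  tensor_scale a (tensor_scale b x) = tensor_scale (a * b) x.
Proof. by rewrite -(tensor_reprK x) -!tensor_piZ scalerA. Qed.

Fact tensor_scale1 : left_id 1 tensor_scale.
Proof. by move=> x; rewrite -(tensor_reprK x) -tensor_piZ scale1r. Qed.

Fact tensor_scaleDr : right_distributive tensor_scale +%R.
Proof.
move=> a x y; rewrite -(tensor_reprK x) -(tensor_reprK y).
by rewrite -tensor_piD -!tensor_piZ -tensor_piD scalerDr.
Qed.

Fact tensor_scaleDl x : {morph tensor_scale^~ x : a b / a + b}.
Proof.
by move=> a b; rewrite -(tensor_reprK x) -!tensor_piZ -tensor_piD scalerDl.
Qed.

HB.instance Definition _ := GRing.Zmodule_isLmodule.Build K tensor_alg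
  tensor_scaleA tensor_scale1 tensor_scaleDr tensor_scaleDl.

Fact tensor_pi_linear : linear tensor_pi.
Proof. by move=> a x y; rewrite tensor_piD tensor_piZ. Qed.

HB.instance Definition _ := GRing.isLinear.Build K {malg K[seq V]} tensor_alg _
  tensor_pi tensor_pi_linear.

Definition tens (w : seq V) : tensor_alg := tensor_pi << w >>.

Definition multilinear (W : lmodType K) (f : seq V -> W) : Prop :=
  forall u w a x y,
    f (u ++ (a *: x + y) :: w) = a *: f (u ++ x :: w) + f (u ++ y :: w).

Lemma tens_multilinear : multilinear tens.
Proof.
move=> u w a x y; rewrite /tens -linearP.
by apply/tensor_piP; apply: TensorRelL.
Qed.

Section Lift.

Variables (W : lmodType K) (f : seq V -> W).

Definition malg_lift (x : {malg K[seq V]}) : W :=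
  \sum_(w <- msupp x) x@_w *: f w.

Fact malg_liftEw x (d : {fset seq V}) : (msupp x `<=` d)%fset ->
  malg_lift x = \sum_(w <- d) x@_w *: f w.
Proof.
move=> le; rewrite /malg_lift (big_fset_incl _ le) //= => w _ /mcoeff_outdom ->.
by rewrite scale0r.
Qed.

Fact malg_lift_linear : linear malg_lift.
Proof.
move=> a x y; set d := (msupp x `|` msupp y)%fset.
have ledx : (msupp x `<=` d)%fset by apply: fsubsetUl.
have ledy : (msupp y `<=` d)%fset by apply: fsubsetUr.
have led : (msupp (a *: x + y) `<=` d)%fset.
  apply: (fsubset_trans (msuppD_le _ _)); apply: fsetUSS => //.
  exact: msuppZ_le.
rewrite (malg_liftEw led) (malg_liftEw ledx) (malg_liftEw ledy).
rewrite scaler_sumr -big_split /=; apply: eq_bigr => w _.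
by rewrite mcoeffD mcoeffZ scalerDl scalerA.
Qed.

HB.instance Definition _ := GRing.isLinear.Build K {malg K[seq V]} W _
  malg_lift malg_lift_linear.

Fact malg_liftU w : malg_lift << w >> = f w.
Proof.
by rewrite (malg_liftEw msuppU_le) big_seq_fset1 mcoeffUU scale1r.
Qed.

Fact malg_lift_rel x : multilinear f -> tensor_rel x -> malg_lift x = 0.
Proof.
move=> hf; elim=> [|a {}x y _ hx _ hy|u w a {}x y].
- exact: linear0.
- by rewrite linearP /= hx hy scaler0 addr0.
- by rewrite linearB /= linearP /= !malg_liftU hf subrr.
Qed.

Definition tlift of multilinear f := fun x : tensor_alg =>
  malg_lift (tensor_repr x).

Hypothesis hf : multilinear f.

Fact tlift_pi x : tlift hf (tensor_pi x) = malg_lift x.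
Proof.
apply/eqP; rewrite -subr_eq0 -linearB; apply/eqP/(malg_lift_rel hf).
by apply/tensor_piP; rewrite tensor_reprK.
Qed.

Fact tlift_linear : linear (tlift hf).
Proof.
move=> a x y; rewrite -(tensor_reprK x) -(tensor_reprK y) -linearP.
by rewrite !tlift_pi linearP.
Qed.

HB.instance Definition _ := GRing.isLinear.Build K tensor_alg W _
  (tlift hf) tlift_linear.

Lemma tliftE w : tlift hf (tens w) = f w.
Proof. by rewrite tlift_pi malg_liftU. Qed.

End Lift.

Lemma eq_tens (W : lmodType K) (F G : {linear tensor_alg -> W}) :
  (forall w, F (tens w) = G (tens w)) -> F =1 G.
Proof.
move=> eFG x; rewrite -(tensor_reprK x) (monalgE (tensor_repr x)).
rewrite !linear_sum /=; apply: eq_bigr => w _.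
have -> : << (tensor_repr x)@_w *g w >> = (tensor_repr x)@_w *: << w >>.
  by apply/malgP=> k; rewrite mcoeffZ !mcoeffU mulrnAr mulr1.
by rewrite !linearZ /= eFG.
Qed.

Section Power.

Variable m : nat.

Fact word_proj_multilinear :
  multilinear (fun w : seq V => if size w == m then tens w else 0).
Proof.
move=> u w a x y; rewrite !size_cat /=; case: ifP => _.
  exact: tens_multilinear.
by rewrite scaler0 addr0.
Qed.

(* The projection of TV = (+)_k V^(x)k on its summand V^(x)m. *)
Definition tensor_proj : {linear tensor_alg -> tensor_alg} :=
  tlift word_proj_multilinear.

Fact tensor_projE w : tensor_proj (tens w) = if size w == m then tens w else 0.
Proof. exact: tliftE. Qed.

Fact tensor_projK x : tensor_proj (tensor_proj x) = tensor_proj x.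
Proof.
have := @eq_tens _ (tensor_proj \o tensor_proj) tensor_proj; apply=> w /=.
by rewrite tensor_projE; case: ifP => e; rewrite ?tensor_projE ?e ?linear0.
Qed.

Definition in_tensor_pow : {pred tensor_alg} := fun x => tensor_proj x == x.

Fact in_tensor_pow_submod : submod_closed in_tensor_pow.
Proof.
split=> [|a x y]; rewrite /in_mem /= /in_tensor_pow.
  by rewrite linear0.
by move=> /eqP hx /eqP hy; rewrite linearP /= hx hy.
Qed.

HB.instance Definition _ :=
  GRing.isSubmodClosed.Build K tensor_alg in_tensor_pow in_tensor_pow_submod.

(* V^(x)m as the subspace of TV spanned by the words of length m. *)
Record tensor_pow : Type :=
  TensorPow { tensor_pow_val : tensor_alg; _ : tensor_pow_val \in in_tensor_pow }.

HB.instance Definition _ := [isSub for tensor_pow_val].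
HB.instance Definition _ := [Choice of tensor_pow by <:].
HB.instance Definition _ := [SubChoice_isSubLmodule of tensor_pow by <:].

Fact to_pow_subproof x : tensor_proj x \in in_tensor_pow.
Proof. by rewrite /in_mem /= /in_tensor_pow tensor_projK. Qed.

Definition to_pow (x : tensor_alg) : tensor_pow := TensorPow (to_pow_subproof x).

Fact to_pow_linear : linear to_pow.
Proof. by move=> a x y; apply: val_inj; rewrite /= linearP. Qed.

HB.instance Definition _ := GRing.isLinear.Build K tensor_alg tensor_pow _
  to_pow to_pow_linear.

End Power.

End TensorAlgebra.

Arguments tens {K V} w.
Arguments to_pow {K V} m x.
Arguments tensor_pow {K} V m.
Arguments tensor_alg {K} V.

Fact size_splice (V : Type) (u w : seq V) x y :
  size (u ++ x :: w) = size (u ++ y :: w).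
Proof. by rewrite !size_cat. Qed.

(* An internal grading A = (+)_i A_i given by the projections on the A_i; the
   component A_i is the set of fixed points of the projection gcomp i. *)
Record grading (K : fieldType) (A : lmodType K) := Grading {
  gcomp : int -> {linear A -> A};
  gcompE : forall i j a, gcomp i (gcomp j a) = if i == j then gcomp j a else 0;
  gcomp_sum : forall a, exists s : seq int, uniq s && (a == \sum_(i <- s) gcomp i a)
}.

Section Grading.

Variables (K : fieldType) (A : lmodType K) (g : grading A).

Definition homog (i : int) : {pred A} := fun a => gcomp g i a == a.

Definition gsupp (a : A) : seq int := xchoose (gcomp_sum g a).

(* The linear map a |-> (-1)^(p |a|) a by which an operator of degree p passes a. *)
Definition koszul (p : int) (a : A) : A :=
  \sum_(i <- gsupp a) (-1) ^ (p * i) *: gcomp g i a.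

Fact gcomp_supp s a i : uniq s && (a == \sum_(j <- s) gcomp g j a) ->
  gcomp g i a != 0 -> i \in s.
Proof.
case/andP=> us /eqP ea; apply: contraR => iNs.
rewrite ea linear_sum big_seq big1 //= => j js; rewrite gcompE.
by case: eqP => // eij; rewrite -eij (negPf iNs) in js.
Qed.

Fact koszulEw p s a : uniq s -> (forall i, gcomp g i a != 0 -> i \in s) ->
  koszul p a = \sum_(i <- s) (-1) ^ (p * i) *: gcomp g i a.
Proof.
move=> us hs; have /= h := xchooseP (gcomp_sum g a).
have red (t : seq int) : \sum_(i <- t) (-1) ^ (p * i) *: gcomp g i a =
    \sum_(i <- [seq i <- t | gcomp g i a != 0]) (-1) ^ (p * i) *: gcomp g i a.
  rewrite big_filter [RHS]big_mkcond /=; apply: eq_bigr => i _.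
  by case: eqP => //= ->; rewrite scaler0.
rewrite /koszul red [RHS]red; apply/perm_big/uniq_perm.
- by apply: filter_uniq; case/andP: h.
- exact: filter_uniq.
- move=> i; rewrite !mem_filter; case: eqP => //= /eqP ni.
  by rewrite hs // (gcomp_supp h).
Qed.

Fact koszul_linear p : linear (koszul p).
Proof.
move=> a x y; pose s := undup (gsupp x ++ gsupp y).
have sx i : gcomp g i x != 0 -> i \in s.
  by move=> h; rewrite mem_undup mem_cat (gcomp_supp (xchooseP (gcomp_sum g x)) h).
have sy i : gcomp g i y != 0 -> i \in s.
  move=> h; rewrite mem_undup mem_cat.
  by rewrite (gcomp_supp (xchooseP (gcomp_sum g y)) h) orbT.
have us : uniq s := undup_uniq _.
rewrite !(@koszulEw p s) //; last first.
  move=> i; apply: contraR => iNs; rewrite linearP /=.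
  have -> : gcomp g i x = 0 by apply/eqP; apply: contraR iNs; apply: sx.
  have -> : gcomp g i y = 0 by apply/eqP; apply: contraR iNs; apply: sy.
  by rewrite scaler0 addr0.
rewrite scaler_sumr -big_split /=; apply: eq_bigr => i _.
by rewrite linearP /= scalerDr !scalerA mulrC.
Qed.

HB.instance Definition _ p := GRing.isLinear.Build K A A _
  (koszul p) (koszul_linear p).

Lemma koszulE p i a : homog i a -> koszul p a = (-1) ^ (p * i) *: a.
Proof.
rewrite /homog => /eqP ha; rewrite (@koszulEw p [:: i]) ?big_seq1 ?ha //.
move=> j; rewrite -ha gcompE inE; case: (j == i) => //; by rewrite eqxx.
Qed.

Fact shift_gcompE i j a : gcomp g (i - 1) (gcomp g (j - 1) a) =
  if i == j then gcomp g (j - 1) a else 0.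
Proof. by rewrite gcompE (inj_eq (addIr _)). Qed.

Fact shift_gcomp_sum a : exists s : seq int,
  uniq s && (a == \sum_(i <- s) gcomp g (i - 1) a).
Proof.
have /andP[us /eqP ea] := xchooseP (gcomp_sum g a).
exists [seq i + 1 | i <- gsupp a]; rewrite (map_inj_uniq (addIr _)) us /=.
rewrite big_map {1}ea; apply/eqP; apply: eq_bigr => i _.
by rewrite addrK.
Qed.

(* (sA)_i = A_(i-1): sA is A with this grading and s is the identity map. *)
Definition shift : grading A := Grading shift_gcompE shift_gcomp_sum.

End Grading.

Section IterLinear.

Variables (K : fieldType) (V : lmodType K) (f : {linear V -> V}) (n : nat).

Definition iterlin (x : V) : V := iter n f x.

Fact iterlin_linear : linear iterlin.
Proof.
by rewrite /iterlin => a x y; elim: n => //= k ->; rewrite linearP.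
Qed.

HB.instance Definition _ := GRing.isLinear.Build K V V _ iterlin iterlin_linear.

End IterLinear.

Section Operators.

Variables (K : fieldType) (V : lmodType K) (g : grading V).

Section Tmap.

Variable f : {linear V -> V}.

Fact tmap_multilinear : multilinear (fun w : seq V => tens (map f w)).
Proof. by move=> u w a x y; rewrite !map_cat /= linearP /= tens_multilinear. Qed.

(* f (x) .. (x) f on each tensor power, for f of degree 0. *)
Definition tmap : {linear tensor_alg V -> tensor_alg V} :=
  tlift tmap_multilinear.

End Tmap.

Section Place.

Variables (f : {linear V -> V}) (p : int) (r m t : nat).
Variable rho : {linear tensor_pow V m -> V}.

Definition place_word (w : seq V) : tensor_alg V :=
  if size w == (r + m + t)%N then
    tens (map (f \o koszul g p) (take r w)
          ++ rho (to_pow m (tens (take m (drop r w)))) :: map f (drop (r + m) w))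
  else 0.

Fact tens_multilinear_tail P q L R b x y :
  tens (P ++ q :: L ++ (b *: x + y) :: R) =
  b *: tens (P ++ q :: L ++ x :: R) + tens (P ++ q :: L ++ y :: R) :> tensor_alg V.
Proof.
by have := tens_multilinear (P ++ q :: L) R b x y; rewrite -!catA.
Qed.

Fact place_multilinear : multilinear place_word.
Proof.
move=> u w a x y; rewrite /place_word !size_cat /=.
case: eqP => _; last by rewrite scaler0 addr0.
rewrite !take_cat !drop_cat; case: (ltnP r (size u)) => ru.
- rewrite !take_cat size_drop ltn_subRL; case: (ltnP (r + m) (size u)) => rmu.
    by rewrite !map_cat /= linearP /= tens_multilinear_tail.
  have -> : (m - (size u - r) = r + m - size u)%N.
    by rewrite (subnBA _ (ltnW ru)) addnC.
  case: (r + m - size u)%N => [|k] /=.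
    by rewrite linearP /= (tens_multilinear_tail _ _ [::]).
  by rewrite tens_multilinear !linearP /= tens_multilinear.
- have -> : (r + m < size u)%N = false.
    by apply/negbTE; rewrite -leqNgt (leq_trans ru) // leq_addr.
  case e : (r - size u)%N => [|k] /=.
    have -> : (r + m - size u = m)%N by rewrite -addnBAC // e.
    case: (m) (rho) => [|k] rho' /=.
      by rewrite linearP /= (tens_multilinear_tail _ _ [::]).
    by rewrite (tens_multilinear [::]) !linearP /= tens_multilinear.
  have -> : (r + m - size u = k.+1 + m)%N by rewrite -addnBAC // e.
  by rewrite /= !map_cat /= !linearP /= -!catA !cat_cons tens_multilinear.
Qed.

(* f^(x)r (x) rho (x) f^(x)t on V^(x)(r+m+t), and 0 on the other tensor powers;
   rho has degree p, f has degree 0, and the Koszul rule gives the sign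
   (-1)^(p (|v_1| + .. + |v_r|)) (see placeE). *)
Definition place : {linear tensor_alg V -> tensor_alg V} :=
  tlift place_multilinear.

End Place.

End Operators.

Section Homogeneous.

Variables (K : fieldType) (V : lmodType K) (g : grading V).

Fact tens_map_koszul (f : {linear V -> V}) p ds u w : all2 (homog g) ds u ->
  tens (map (f \o koszul g p) u ++ w) =
  (-1) ^ (p * \sum_(d <- ds) d) *: tens (map f u ++ w) :> tensor_alg V.
Proof.
have scale_letter P R c v :
    tens (P ++ (c *: v) :: R) = c *: tens (P ++ v :: R) :> tensor_alg V.
  have z : tens (P ++ 0 :: R) = 0 :> tensor_alg V.
    have := tens_multilinear P R 1 (0 : V) 0.
    by rewrite !scale1r addr0 => /eqP; rewrite -subr_eq subrr eq_sym => /eqP.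
  by have := tens_multilinear P R c v 0; rewrite addr0 z addr0.
rewrite -[map _ u ++ w]cat0s -[map f u ++ w]cat0s.
elim: u ds [::] => [|v u IH] [|d ds] P //=.
  by rewrite big_nil mulr0 expr0z scale1r.
case/andP => hd hds.
rewrite (koszulE p hd) linearZ /= scale_letter.
rewrite -cat_rcons (IH _ _ hds) cat_rcons scalerA big_cons mulrDr expfzDr //.
by rewrite oppr_eq0 oner_eq0.
Qed.

Lemma placeE f p r m t rho ds w :
  size w = (r + m + t)%N -> all2 (homog g) ds w ->
  place g f p r t rho (tens w) =
  (-1) ^ (p * \sum_(d <- take r ds) d) *:
    tens (map f (take r w)
          ++ rho (to_pow m (tens (take m (drop r w)))) :: map f (drop (r + m) w)).
Proof.
move=> sw hw; rewrite [LHS]tliftE /place_word sw eqxx (@tens_map_koszul _ _ (take r ds)) //.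
elim: r w ds {sw} hw => [|r IH] [|v w] [|d ds] //= /andP[-> h] /=.
exact: IH.
Qed.

End Homogeneous.

Section Coderivations.

Variables (K : fieldType) (V : lmodType K) (g : grading V).
Variable alpha : {linear V -> V}.

(* It suffices to test the degree on products of homogeneous vectors, which
   span the graded components of V^(x)m. *)
Definition has_degree (p : int) (m : nat) (rho : tensor_pow V m -> V) : Prop :=
  forall ds w, size w = m -> all2 (homog g) ds w ->
    homog g (\sum_(d <- ds) d + p) (rho (to_pow m (tens w))).

Definition equivariant (m : nat) (rho : tensor_pow V m -> V) : Prop :=
  forall x : tensor_pow V m, alpha (rho x) = rho (to_pow m (tmap alpha (val x))).

Section Tilde.

Variables (p : int) (m : nat) (rho : {linear tensor_pow V m -> V}).

Definition tilde_word (w : seq V) : tensor_alg V :=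
  \sum_(0 <= i < (size w).+1 - m)
    place g (iterlin alpha m.-1) p i (size w - m - i) rho (tens w).

Fact tilde_multilinear : multilinear tilde_word.
Proof.
move=> u w a x y; rewrite /tilde_word !(size_splice u w _ 0).
rewrite scaler_sumr -big_split; apply: eq_bigr => i _ /=.
by rewrite tens_multilinear linearP.
Qed.

Definition tilde : {linear tensor_alg V -> tensor_alg V} :=
  tlift tilde_multilinear.

Lemma tildeE ds w : all2 (homog g) ds w ->
  tilde (tens w) = \sum_(0 <= i < (size w).+1 - m)
    (-1) ^ (p * \sum_(d <- take i ds) d) *:
      tens (map (iter m.-1 alpha) (take i w)
            ++ rho (to_pow m (tens (take m (drop i w))))
            :: map (iter m.-1 alpha) (drop (i + m) w)).
Proof.
move=> hw; rewrite [LHS]tliftE /tilde_word big_nat [RHS]big_nat.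
apply: eq_bigr => i /andP[_ hi]; rewrite (placeE _ _ _ _ hw) //.
have le : (i + m <= size w)%N by move: hi; rewrite ltn_subRL ltnS addnC.
by rewrite -subnDA [(m + i)%N]addnC subnKC.
Qed.

End Tilde.

Section Coder.

Variables (p : int) (rho : forall m, {linear tensor_pow V m -> V}).

(* sum_(m >= 1) of the tilde rho_m: on a word of length k only m <= k contributes. *)
Definition coder_word (w : seq V) : tensor_alg V :=
  \sum_(1 <= m < (size w).+1) tilde p (rho m) (tens w).

Fact coder_multilinear : multilinear coder_word.
Proof.
move=> u w a x y; rewrite /coder_word !(size_splice u w _ 0).
rewrite scaler_sumr -big_split; apply: eq_bigr => i _ /=.
by rewrite tens_multilinear linearP.
Qed.

Definition coder : {linear tensor_alg V -> tensor_alg V} :=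
  tlift coder_multilinear.

End Coder.

Definition Coder (p : int) (E : tensor_alg V -> tensor_alg V) : Prop :=
  exists rho : forall m, {linear tensor_pow V m -> V},
    (forall m, (0 < m)%N -> has_degree p (rho m) /\ equivariant (rho m))
    /\ E =1 coder p rho.

End Coderivations.

Section Desuspension.

Variables (K : fieldType) (A : lmodType K) (g : grading A).

(* (s^-1)^(x)k on (sA)^(x)k: as s^-1 has degree -1 and s is the identity of the
   underlying space, the Koszul rule gives
   v_1 .. v_k |-> (-1)^(sum_i (k - i) |v_i|) v_1 .. v_k, |v_i| the degree in sA. *)
Fixpoint desusp_word (w : seq A) : seq A :=
  if w is v :: w' then koszul (shift g) (- (size w')%:Z) v :: desusp_word w'
  else [::].

Fact desusp_multilinear : multilinear (fun w => tens (desusp_word w)).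
Proof.
move=> u w a x y; rewrite -[desusp_word _]cat0s.
rewrite -[desusp_word (_ ++ x :: _)]cat0s -[desusp_word (_ ++ y :: _)]cat0s.
elim: u [::] => [|v u IH] P /=; first by rewrite linearP /= tens_multilinear.
rewrite !(size_splice u w _ 0) -!(cat_rcons _ P).
exact: IH.
Qed.

Definition desusp : {linear tensor_alg A -> tensor_alg A} :=
  tlift desusp_multilinear.

End Desuspension.

Record HAinf (K : fieldType) := HAInf {
  ha_space : lmodType K;
  ha_grading : grading ha_space;
  (* ha_mu 0 is never used. *)
  ha_mu : forall k, {linear tensor_pow ha_space k -> ha_space};
  ha_alpha : {linear ha_space -> ha_space};
  ha_mu_degree : forall k, (0 < k)%N ->
    has_degree ha_grading (k%:Z - 2) (ha_mu k);
  ha_alpha_degree : forall i a,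
    homog ha_grading i a -> homog ha_grading i (ha_alpha a);
  ha_alpha_neq0 : exists a, ha_alpha a != 0;
  ha_alpha_mu : forall k, (0 < k)%N -> equivariant ha_alpha (ha_mu k);
  ha_relation : forall (N : nat) (x : tensor_pow ha_space N), (0 < N)%N ->
    \sum_(r < N.+1) \sum_(s < N.+1 | (0 < s)%N) \sum_(t < N.+1 | (r + s + t == N)%N)
      (-1) ^+ (r * s + t) *:
        ha_mu (r + 1 + t) (to_pow (r + 1 + t)
          (place ha_grading (iterlin ha_alpha s.-1) (s%:Z - 2) r t (ha_mu s) (val x)))
    = 0
}.

Section HochschildComplex.

Variables (K : fieldType) (X : HAinf K).

Local Notation TV := (tensor_alg (ha_space X)).
Local Notation gV := (shift (ha_grading X)).

Definition ha_rho (k : nat) :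
    {linear tensor_pow (ha_space X) k -> ha_space X} :=
  ha_mu X k \o to_pow k \o desusp (ha_grading X) \o val.

Definition ha_D : TV -> TV := coder gV (ha_alpha X) (-1) ha_rho.

Definition ha_Coder (p : int) (E : TV -> TV) : Prop :=
  Coder gV (ha_alpha X) p E.

Definition bracket (p q : int) (E F : TV -> TV) (x : TV) : TV :=
  E (F x) - (-1) ^ (p * q) *: F (E x).

Definition cochain (p : int) (E : TV -> TV) : Prop := ha_Coder (- (p - 1)) E.

Definition delta (p : int) (E : TV -> TV) : TV -> TV :=
  bracket (-1) (- (p - 1)) ha_D E.

Definition cocycle (p : int) (E : TV -> TV) : Prop :=
  cochain p E /\ forall x, delta p E x = 0.

Definition coboundary (p : int) (E : TV -> TV) : Prop :=
  exists2 F, cochain (p - 1) F & E =1 delta (p - 1) F.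

(* H^p_alpha(A,A) = 0 *)
Definition hochschild_vanishes (p : int) : Prop :=
  forall E, cocycle p E -> coboundary p E.

(* D_t = sum_(i <= n) t^i Dt_i; the values Dt i for i > n are irrelevant. *)
Record deformation (n : nat) (Dt : nat -> TV -> TV) : Prop := Deformation {
  deformation0 : Dt 0 =1 ha_D;
  deformation_Coder : forall i, (0 < i <= n)%N -> ha_Coder (-1) (Dt i);
  deformation_eq : forall l, (l <= n)%N ->
    forall x, \sum_(i < l.+1) Dt i (Dt (l - i)%N x) = 0
}.

Definition extends (n : nat) (Dt : nat -> TV -> TV) : Prop :=
  exists2 E, ha_Coder (-1) E &
    deformation n.+1 (fun i => if i == n.+1 then E else Dt i).

End HochschildComplex.

(* Main.v *)
Require Import Defs.
From HB Require Import structures.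
From mathcomp Require Import all_boot all_order all_algebra.
From mathcomp Require Import zify.

Set Implicit Arguments.
Unset Strict Implicit.
Unset Printing Implicit Defensive.

Import GRing.Theory.

Local Open Scope ring_scope.

(* The obstruction Ob = sum_(i + j = n + 1, i, j >= 1) D_i D_j is half a sum of
   graded commutators [D_i, D_j], and a graded commutator of coderivations is a
   coderivation: in the composite of two tilde maps, the terms where the two
   maps act on disjoint blocks of letters cancel against those of the opposite
   composite (equivariance makes the twists by alpha agree), and the terms where
   one map is inserted in the other form the tilde map of a Gerstenhaber-type
   composition.  Associativity and the equations of order at most n give
   [D, Ob] = 0, so Ob is a 3-cocycle; if Ob = [D, F] then D_(n+1) = - F. *)

(** * Block decompositions of words; linear maps tested on homogeneous words *)

Lemma size_addP (T : Type) (w : seq T) m n : size w = (m + n)%N ->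
  exists u v, [/\ w = u ++ v, size u = m & size v = n].
Proof.
move=> sw; exists (take m w), (drop m w).
by rewrite cat_take_drop size_takel ?size_drop sw ?leq_addr ?addKn.
Qed.

Lemma all2_catP (S T : Type) (r : S -> T -> bool) s u v :
  all2 r s (u ++ v) ->
  exists s1 s2, [/\ s = s1 ++ s2, all2 r s1 u & all2 r s2 v].
Proof.
elim: u s => [|x u IH] s /=; first by exists [::], s.
case: s => // y s /andP[yx /IH[s1 [s2 [-> h1 h2]]]].
by exists (y :: s1), s2; rewrite /= yx.
Qed.

Lemma all2_catl (S T : Type) (r : S -> T -> bool) s u s' u' :
  all2 r s u -> all2 r (s ++ s') (u ++ u') = all2 r s' u'.
Proof. by elim: s u => [|y s IH] [|x u] //= /andP[-> /IH]. Qed.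

Section TensorWords.

Variables (K : fieldType) (V : lmodType K).

(** One letter is singled out so that the word becomes a bundled linear map in that letter. *)
Definition tens_at (u w : seq V) (x : V) : tensor_alg V := tens (u ++ x :: w).

Fact tens_at_linear u w : linear (tens_at u w).
Proof. by move=> a x y; apply: tens_multilinear. Qed.

HB.instance Definition _ u w := GRing.isLinear.Build K V (tensor_alg V) _
  (tens_at u w) (tens_at_linear u w).

Lemma tens_atE u w x : tens (u ++ x :: w) = tens_at u w x.
Proof. by []. Qed.

Lemma tmapE (f : {linear V -> V}) w : tmap f (tens w) = tens (map f w).
Proof. exact: tliftE. Qed.

Lemma val_to_pow m w : size w = m ->
  val (to_pow m (tens w)) = tens w :> tensor_alg V.
Proof. by move=> sw; rewrite [LHS]tensor_projE sw eqxx. Qed.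

Lemma to_pow_val m (x : tensor_pow V m) : to_pow m (val x) = x.
Proof. by apply: val_inj; apply/eqP; case: x. Qed.

Lemma to_pow_neq m w : size w != m -> to_pow m (tens w) = 0 :> tensor_pow V m.
Proof. by move=> sw; apply: val_inj; rewrite [LHS]tensor_projE (negPf sw). Qed.

Lemma tensor_pow_ext (W : lmodType K) m (F G : {linear tensor_pow V m -> W}) :
  (forall w, size w = m -> F (to_pow m (tens w)) = G (to_pow m (tens w))) ->
  F =1 G.
Proof.
move=> h x; rewrite -(to_pow_val x).
apply: (@eq_tens _ _ _ (F \o to_pow m) (G \o to_pow m)) => w /=.
have [/h // | sw] := eqVneq (size w) m.
by rewrite to_pow_neq // !linear0.
Qed.

Section Graded.

Variable g : grading V.

Lemma homog_ext (W : lmodType K) (F G : {linear V -> W}) :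
  (forall i a, homog g i a -> F a = G a) -> F =1 G.
Proof.
move=> h x; have /andP[_ /eqP ->] := xchooseP (gcomp_sum g x).
rewrite !linear_sum; apply: eq_bigr => i _; apply: (h i).
by rewrite /homog gcompE eqxx.
Qed.

(** Homogeneous words span: in [u ++ v] with [u] already homogeneous, the first letter of [v] is
    split into its components and moved into [u]. *)
Lemma tens_homog_ext (W : lmodType K) (F G : {linear tensor_alg V -> W}) :
  (forall ds w, all2 (homog g) ds w -> F (tens w) = G (tens w)) -> F =1 G.
Proof.
move=> h; apply: eq_tens => w.
suff H v ds u : all2 (homog g) ds u -> F (tens (u ++ v)) = G (tens (u ++ v)).
  exact: (H w [::] [::]).
elim: v ds u => [|x v IH] ds u hu; first by rewrite cats0; apply: h hu.
apply: (@homog_ext _ (F \o tens_at u v) (G \o tens_at u v)) => i a ha /=.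
rewrite /tens_at -cat_rcons; apply: (IH (rcons ds i)).
by rewrite -!cats1 (all2_catl _ _ hu) /= ha.
Qed.

Lemma homogZ i c a : homog g i a -> homog g i (c *: a).
Proof. by rewrite /homog linearZ /= => /eqP->. Qed.

Lemma koszulD p q x : koszul g p (koszul g q x) = koszul g (p + q) x.
Proof.
move: x; apply: (@homog_ext _ (koszul g p \o koszul g q)) => i a ha /=.
rewrite (koszulE q ha) linearZ /= !(koszulE _ ha) scalerA mulrDl.
rewrite -expfzDr 1?addrC //.
by rewrite oppr_eq0 oner_eq0.
Qed.

Lemma sign_int_sqr (n : int) : (-1 : K) ^ n * (-1) ^ n = 1.
Proof. by rewrite -expfzMl mulrNN mulr1 exp1rz. Qed.

(** The output degree exceeds the sum of the letter degrees by [p], so its sign is the product of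
    the letter signs times (-1)^(pq). This factor becomes the sign of the graded commutator. *)
Lemma has_degree_koszul p m (rho : {linear tensor_pow V m -> V}) q w :
  has_degree g p rho ->
  koszul g q (rho (to_pow m (tens w))) =
    (-1) ^ (p * q) *: rho (to_pow m (tens (map (koszul g q) w))).
Proof.
move=> hr; rewrite -tmapE.
pose G : {linear tensor_alg V -> V} :=
  ( *:%R ((-1) ^ (p * q)) \o (rho \o to_pow m \o tmap (koszul g q))).
apply: (@tens_homog_ext _ (koszul g q \o rho \o to_pow m) G) => ds v hv /=.
have [sv|sv] := eqVneq (size v) m; last first.
  by rewrite tmapE !to_pow_neq ?size_map // !linear0.
rewrite (koszulE q (hr _ _ sv hv)) tmapE.
(* The identity map and an empty tail isolate the product of the letter signs. *)
have := tens_map_koszul idfun q [::] hv; rewrite !cats0 map_id.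
rewrite (eq_map (g := koszul g q)) // => ->.
rewrite !linearZ /= scalerA (mulrC p) mulrDr expfzDr //.
by rewrite oppr_eq0 oner_eq0.
Qed.

Section Place.

Variables (f : {linear V -> V}) (p : int).

(** Unlike in [placeE], the letters need not be homogeneous: the sign stays inside the operator
    [koszul]. *)
Lemma place_catE m (rho : {linear tensor_pow V m -> V}) a b c r t :
  size a = r -> size b = m -> size c = t ->
  place g f p r t rho (tens (a ++ b ++ c)) =
  tens (map (f \o koszul g p) a ++ rho (to_pow m (tens b)) :: map f c).
Proof.
move=> <- sb <-; rewrite [LHS]tliftE /place_word !size_cat sb addnA eqxx.
rewrite take_size_cat // drop_size_cat // take_size_cat //.
by rewrite catA drop_size_cat // size_cat sb.
Qed.

(** A word goes to a single word, so the expansion [coder_tens] can be applied again after an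
    insertion. *)
Lemma place_size m (rho : {linear tensor_pow V m -> V}) r t w :
  size w = (r + m + t)%N -> exists2 w', size w' = (r + 1 + t)%N &
    place g f p r t rho (tens w) = tens w'.
Proof.
move=> sw; rewrite [place _ _ _ _ _ _ _]tliftE /place_word sw eqxx.
eexists; last by [].
rewrite size_cat /= !size_map size_takel ?size_drop sw; lia.
Qed.

End Place.

End Graded.

End TensorWords.

(** * Composites of two insertions: disjoint and nested blocks *)

Section PlaceComp.

Variables (K : fieldType) (V : lmodType K) (g : grading V).
Variable alpha : {linear V -> V}.
Hypothesis alpha_degree : forall i a, homog g i a -> homog g i (alpha a).

Lemma koszul_iter p n x :
  koszul g p (iter n alpha x) = iter n alpha (koszul g p x).
Proof.
suff c y : koszul g p (alpha y) = alpha (koszul g p y).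
  by elim: n => //= n IH; rewrite c IH.
apply: (@homog_ext _ _ g _ (koszul g p \o alpha) (alpha \o koszul g p)) => i a ha.
by rewrite /= (koszulE p ha) (koszulE p (alpha_degree ha)) linearZ.
Qed.

Lemma equivariant_tens m (rho : {linear tensor_pow V m -> V}) w :
  equivariant alpha rho -> size w = m ->
  alpha (rho (to_pow m (tens w))) = rho (to_pow m (tens (map alpha w))).
Proof. by move=> er sw; rewrite er val_to_pow // tmapE. Qed.

Lemma equivariant_iter m (rho : {linear tensor_pow V m -> V}) n w :
  equivariant alpha rho -> size w = m ->
  iter n alpha (rho (to_pow m (tens w))) =
    rho (to_pow m (tens (map (iter n alpha) w))).
Proof.
move=> er sw; elim: n => [|n /= ->]; first by rewrite map_id.
by rewrite equivariant_tens ?size_map // -map_comp.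
Qed.

Variables (p q : int) (m k : nat).
Variables (rho : {linear tensor_pow V m.+1 -> V}).
Variables (sigma : {linear tensor_pow V k.+1 -> V}).
Hypotheses (rho_degree : has_degree g p rho) (rho_alpha : equivariant alpha rho).
Hypothesis sigma_alpha : equivariant alpha sigma.

(** Write [w] as five blocks, with [rho] acting on the second and [sigma] on the fourth. On the
    right [sigma] passes the output of [rho] instead of its inputs, which costs (-1)^(pq). Letters
    outside both blocks receive [alpha] to the power [m + k] on either side, and equivariance moves
    the power of [alpha] on an output to its inputs. *)
Lemma place_disjoint r c t w : size w = (r + m.+1 + c + k.+1 + t)%N ->
  place g (iterlin alpha m) p r (c + 1 + t) rho
    (place g (iterlin alpha k) q (r + m.+1 + c) t sigma (tens w)) =
  (-1) ^ (p * q) *: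
  place g (iterlin alpha k) q (r + 1 + c) t sigma
    (place g (iterlin alpha m) p r (c + k.+1 + t) rho (tens w)).
Proof.
move/size_addP=> [{}w [w5 [-> sw s5]]].
have [{}w [w4 [-> {}sw s4]]] := size_addP sw.
have [{}w [w3 [-> {}sw s3]]] := size_addP sw.
have [w1 [w2 [-> s1 s2]]] := size_addP sw.
rewrite -[in LHS]catA (@place_catE _ _ _ _ _ _ sigma) //; last first.
  by rewrite !size_cat s1 s2 s3.
rewrite -!catA (@place_catE _ _ _ _ _ _ rho) //; last first.
  by rewrite !size_cat s3 s4 s5 addnA.
rewrite !map_cat -!catA (@place_catE _ _ _ _ _ _ rho) ?size_map //; last first.
  by rewrite size_cat /= !size_map s3 s5 -addnA.
rewrite -[in RHS]cat_rcons [in RHS]catA.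
rewrite (@place_catE _ _ _ _ _ _ sigma) ?size_map //; last first.
  by rewrite size_cat size_rcons !size_map s1 s3 addn1.
rewrite !map_cat map_rcons cat_rcons -!catA /= -!map_comp.
rewrite (has_degree_koszul _ _ rho_degree) linearZ /=.
rewrite !tens_atE linearZ /= scalerA sign_int_sqr scale1r /tens_at /iterlin.
rewrite !equivariant_iter ?size_map //.
have iterK x y z : iter x alpha (iter y alpha z) = iter (x + y) alpha z.
  by rewrite iterD.
by congr tens; congr (_ ++ _ :: _ ++ _ :: _); rewrite -?map_comp;
  [|congr (rho (to_pow _ (tens _))) | |]; apply: eq_map => x /=;
  rewrite ?koszul_iter !iterK ?koszulD addnC // addrC.
Qed.

(** Letters outside the outer block collect [alpha] to the power [m + k] and the sign of an operator
    of degree [p + q]. This is the twist that a tilde map of arity [m + k + 1] and degree [p + q]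
    requires. *)
Lemma place_nested r b b' t w : (b + b' = m)%N ->
  size w = (r + (b + k.+1 + b') + t)%N ->
  place g (iterlin alpha m) p r t rho
    (place g (iterlin alpha k) q (r + b) (b' + t) sigma (tens w)) =
  tens (map (iterlin alpha (m + k) \o koszul g (p + q)) (take r w) ++
    rho (to_pow m.+1 (place g (iterlin alpha k) q b b' sigma
      (tens (take (b + k.+1 + b') (drop r w)))))
    :: map (iterlin alpha (m + k)) (drop (r + (b + k.+1 + b')) w)).
Proof.
move=> bm /size_addP[{}w [w3 [-> sw s3]]].
have [w1 [{}w [-> s1 {}sw]]] := size_addP sw.
rewrite -catA take_size_cat // drop_size_cat // take_size_cat //.
rewrite [X in drop _ X]catA drop_size_cat ?size_cat ?s1 ?sw //.
have [{}w [w22 [-> {}sw s22]]] := size_addP sw.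
have [w20 [w21 [-> s20 s21]]] := size_addP sw.
rewrite -!catA [w1 ++ _]catA !(@place_catE _ _ _ _ _ _ sigma) //; first last.
- by rewrite size_cat s22 s3.
- by rewrite size_cat s1 s20.
rewrite !map_cat -catA -cat_cons.
rewrite [X in _ ++ X]catA (@place_catE _ _ _ _ _ _ rho) ?size_map //; last first.
  by rewrite size_cat /= !size_map s20 s22 addnS bm.
by congr tens; congr (_ ++ _ :: _); rewrite -?map_comp; apply: eq_map => x /=;
  rewrite /iterlin ?koszul_iter iterD ?koszulD.
Qed.

End PlaceComp.

(** * The Gerstenhaber-type composition of two families of maps *)

Section Brace.

Variables (K : fieldType) (V : lmodType K) (g : grading V).
Variable alpha : {linear V -> V}.
Variables (q : int) (rho sigma : forall m, {linear tensor_pow V m -> V}).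

(* Indices are arities minus one: the inner map has k + 1 inputs, the outer one
   M - k + 1, and the composite M + 1. *)
Definition brace_word M k b (x : tensor_alg V) : V :=
  rho (M - k).+1 (to_pow (M - k).+1
    (place g (iterlin alpha k) q b (M - k - b) (sigma k.+1) x)).

(** [M] is now the full arity, hence [M.-1] in [brace_word]. The outer map has [M - k] inputs, and
    [b] runs over the slots that can receive the inner output. *)
Definition brace M (x : tensor_pow V M) : V :=
  \sum_(0 <= k < M) \sum_(0 <= b < M - k) brace_word M.-1 k b (val x).

Fact brace_linear M : linear (@brace M).
Proof.
move=> a x y; rewrite /brace scaler_sumr -big_split; apply: eq_bigr => k _ /=.
rewrite scaler_sumr -big_split; apply: eq_bigr => b _ /=.
by rewrite /brace_word !linearP.
Qed.

HB.instance Definition _ M := GRing.isLinear.Build K (tensor_pow V M) V _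
  (@brace M) (@brace_linear M).

Lemma brace_tens M w : size w = M ->
  brace (to_pow M (tens w)) =
    \sum_(0 <= k < M) \sum_(0 <= b < M - k) brace_word M.-1 k b (tens w).
Proof. by move=> sw; rewrite /brace val_to_pow. Qed.

Lemma has_degree_brace p M :
  (forall i a, homog g i a -> homog g i (alpha a)) ->
  (forall m, (0 < m)%N -> has_degree g p (rho m)) ->
  (forall m, (0 < m)%N -> has_degree g q (sigma m)) ->
  has_degree g (p + q) (@brace M).
Proof.
move=> ha hr hs ds w sw hw; rewrite brace_tens //.
apply/eqP; rewrite linear_sum; apply: eq_big_nat => k hk.
rewrite linear_sum; apply: eq_big_nat => b hb; apply/eqP.
rewrite -/(homog g _ _).
have {}sw : size w = (b + k.+1 + (M.-1 - k - b))%N by lia.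
rewrite /brace_word (placeE _ _ _ sw hw) !linearZ /=; apply: homogZ.
have [w' [w3 [ew sw' s3]]] := size_addP sw.
have [w1 [w2 [ew' s1 s2]]] := size_addP sw'.
move: hw; rewrite ew ew' -!catA {w w' ew ew' sw sw'}.
rewrite take_size_cat // drop_size_cat // take_size_cat //.
rewrite catA drop_size_cat -?catA ?size_cat ?s1 ?s2 //.
move=> /all2_catP[d1 [d' [-> h1 /all2_catP[d2 [d3 [-> h2 h3]]]]]].
(* The outer map sees a word whose middle letter is the output of [sigma], of degree the sum of [d2]
   plus [q]. *)
have := @hr (M.-1 - k).+1 isT (d1 ++ (\sum_(d <- d2) d + q) :: d3)
  (map (iterlin alpha k) w1 ++
     sigma k.+1 (to_pow k.+1 (tens w2)) :: map (iterlin alpha k) w3).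
rewrite size_cat /= !size_map s1 s3 !big_cat big_cons /=.
set e1 := (_ + p); set e2 := (_ + (p + q)).
have -> : e1 = e2 by rewrite /e1 /e2 (addrAC _ q) addrA (addrC p) [RHS]addrA.
apply; first by lia.
have iterh n i a : homog g i a -> homog g i (iter n alpha a).
  by move=> hi; elim: n => //= n; apply: ha.
have maph s w : all2 (homog g) s w -> all2 (homog g) s (map (iterlin alpha k) w).
  by elim: s w => [|i s IH] [|x w] //= /andP[/iterh-> /IH].
by rewrite (all2_catl _ _ (maph _ _ h1)) /= hs ?maph.
Qed.

Lemma equivariant_brace M :
  (forall i a, homog g i a -> homog g i (alpha a)) ->
  (forall m, (0 < m)%N -> equivariant alpha (rho m)) ->
  (forall m, (0 < m)%N -> equivariant alpha (sigma m)) ->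
  equivariant alpha (@brace M).
Proof.
move=> ha hr hs.
apply: (@tensor_pow_ext _ _ _ M (alpha \o @brace M)
  (@brace M \o to_pow M \o tmap alpha \o val)) => w sw.
transitivity (brace (to_pow M (tmap alpha (val (to_pow M (tens w)))))) => //.
transitivity (alpha (brace (to_pow M (tens w)))) => //.
rewrite val_to_pow // tmapE !brace_tens ?size_map // linear_sum.
apply: eq_big_nat => k hk.
rewrite linear_sum; apply: eq_big_nat => b hb.
rewrite /brace_word.
have {}sw : size w = (b + k.+1 + (M.-1 - k - b))%N by lia.
have [{}w [w3 [-> {}sw s3]]] := size_addP sw.
have [w1 [w2 [-> s1 s2]]] := size_addP sw.
rewrite -!catA !map_cat !(@place_catE _ _ _ _ _ _ (sigma _)) ?size_map //.
rewrite (equivariant_tens (hr _ _)) //; last first.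
  by rewrite size_cat /= !size_map s1 s3; lia.
rewrite map_cat /= (equivariant_tens (hs _ _)) //=.
rewrite -!map_comp; congr (rho _ (to_pow _ (tens _))).
congr (_ ++ _ :: _); apply: eq_map => x /=; rewrite /iterlin -iterS iterSr //.
by rewrite -[alpha (koszul g q x)]/(iter 1 alpha _) -koszul_iter.
Qed.

End Brace.

(** * Reindexing of the sums over arities and positions *)

Lemma sum_nat_shift (W : zmodType) (P : pred nat) (F : nat -> W) a L :
  (forall i, P i -> a <= i < L)%N ->
  \sum_(0 <= i < L | P i) F i = \sum_(0 <= j < L | P (j + a)%N) F (j + a)%N.
Proof.
move=> hP; transitivity (\sum_(a <= i < L | P i) F i).
  rewrite [RHS](@big_nat_widenl _ _ _ _ 0) //; apply: eq_bigl => i.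
  by case: (boolP (P i)) => // /hP/andP[->].
rewrite -{1}[a]add0n big_addn [LHS](@big_nat_widen _ _ _ _ _ L) ?leq_subr //.
apply: eq_bigl => j; rewrite ltn_subRL addnC.
by case: (boolP (P _)) => // /hP/andP[_ ->].
Qed.

Lemma sum_nat_window (W : zmodType) (F : nat -> W) r m L : (r + m < L)%N ->
  \sum_(0 <= i < L | (r <= i <= r + m)%N) F i = \sum_(0 <= b < m.+1) F (r + b)%N.
Proof.
move=> rmL; rewrite (@sum_nat_shift _ _ _ r); last first.
  by move=> i /andP[-> /leq_ltn_trans->].
rewrite [RHS](@big_nat_widen _ _ _ _ _ L); last first.
  by apply: leq_trans rmL; rewrite ltnS leq_addl.
by apply: eq_big => j; rewrite addnC // leq_addr leq_add2l.
Qed.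

Lemma sum_nat_triangle (W : zmodType) (G : nat -> nat -> W) L :
  \sum_(0 <= M < L) \sum_(0 <= k < M.+1) G (M - k)%N k =
  \sum_(0 <= m < L) \sum_(0 <= k < L | (m + k < L)%N) G m k.
Proof.
transitivity (\sum_(0 <= M < L) \sum_(0 <= k < L | (k <= M)%N) G (M - k)%N k).
  by apply: eq_big_nat => M /= ML; rewrite (big_nat_widen _ _ L).
rewrite (exchange_big_dep_nat xpredT) //= [RHS](exchange_big_dep_nat xpredT) //=.
apply: eq_big_nat => k /= kL; rewrite big_mkcond [RHS]big_mkcond /=.
transitivity (\sum_(0 <= M < L | (k <= M < L)%N) G (M - k)%N k).
  rewrite [RHS]big_mkcond; apply: eq_big_nat => M /= ->; by rewrite andbT.
rewrite (@sum_nat_shift _ _ _ k) // big_mkcond; apply: eq_bigr => M _.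
by rewrite leq_addl addnK.
Qed.

(** Substitute [m = M - k] and [i = r + b]: from the arity of the composite and the slot inside the
    outer block to the two separate arities and the absolute position of the inner block. *)
Lemma sum_nat_nested (W : zmodType) (T : nat -> nat -> nat -> nat -> W) L :
  \sum_(0 <= M < L) \sum_(0 <= r < L | (r + M < L)%N)
    \sum_(0 <= k < M.+1) \sum_(0 <= b < M.+1 - k) T (M - k)%N k r (r + b)%N =
  \sum_(0 <= m < L) \sum_(0 <= k < L) \sum_(0 <= r < L)
    \sum_(0 <= i < L | (r <= i <= r + m)%N && (r + m + k < L)%N) T m k r i.
Proof.
pose G m k := \sum_(0 <= r < L | (r + m + k < L)%N)
  \sum_(0 <= b < m.+1) T m k r (r + b)%N.
transitivity (\sum_(0 <= M < L) \sum_(0 <= k < M.+1) G (M - k)%N k).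
  apply: eq_big_nat => M /= ML; rewrite [LHS]exchange_big_nat.
  apply: eq_big_nat => k /= kM.
  by apply: eq_big => r; rewrite -?addnA ?subnK // subSn.
rewrite sum_nat_triangle; apply: eq_big_nat => m mL.
rewrite big_mkcond; apply: eq_bigr => k _; rewrite /G.
case: ifP => mkL; last first.
  rewrite big1 // => r _; rewrite big_pred0 // => i.
  rewrite -addnA [(r + (m + k) < L)%N](_ : _ = false) ?andbF //.
  by apply/negbTE; rewrite -leqNgt (leq_trans _ (leq_addl _ _)) // leqNgt mkL.
rewrite big_mkcond; apply: eq_bigr => r _.
case: ifP => rmkL; last by rewrite big_pred0 // => i; rewrite andbF.
under [RHS]eq_bigl do rewrite andbT.
by rewrite sum_nat_window // (leq_trans _ rmkL) // ltnS leq_addr.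
Qed.

(** Trichotomy for [i] against the interval from [r] to [r + m]. In each of the three cases one of
    the two bounds on the left follows from the other and is dropped. *)
Lemma sum_nat_split (W : zmodType) (T : nat -> nat -> nat -> nat -> W) L :
  \sum_(0 <= m < L) \sum_(0 <= k < L) \sum_(0 <= r < L)
    \sum_(0 <= i < L | (i + k < L)%N && (r + m + k < L)%N) T m k r i =
  \sum_(0 <= m < L) \sum_(0 <= k < L) \sum_(0 <= r < L)
    \sum_(0 <= i < L | (r <= i <= r + m)%N && (r + m + k < L)%N) T m k r i +
  (\sum_(0 <= m < L) \sum_(0 <= k < L) \sum_(0 <= r < L)
     \sum_(0 <= i < L | (r + m < i)%N && (i + k < L)%N) T m k r i +
   \sum_(0 <= m < L) \sum_(0 <= k < L) \sum_(0 <= i < L)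
     \sum_(0 <= r < L | (i < r)%N && (r + m + k < L)%N) T m k r i).
Proof.
rewrite -!big_split; apply: eq_bigr => m _; rewrite -!big_split.
apply: eq_bigr => k _ /=.
rewrite [X in _ = _ + (_ + X)](exchange_big_dep_nat xpredT) //=.
rewrite -!big_split; apply: eq_bigr => r _ /=.
rewrite big_mkcond [X in _ = X + _]big_mkcond [X in _ = _ + (X + _)]big_mkcond.
rewrite [X in _ = _ + (_ + X)]big_mkcond -!big_split; apply: eq_bigr => i _ /=.
have -> : (i + k < L)%N && (r + m + k < L)%N =
  [|| (r <= i <= r + m)%N && (r + m + k < L)%N, (r + m < i)%N && (i + k < L)%N
    | (i < r)%N && (r + m + k < L)%N] by clear; lia.
case: (ltnP i r) => h1; case: (ltnP (r + m) i) => h2 /=.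
- by have := leq_trans h1 (leq_addr m r); rewrite leqNgt ltnS (ltnW h2).
- by rewrite !add0r.
- by rewrite orbF add0r addr0.
- by rewrite orbF !addr0.
Qed.

Lemma sum_nat_reorder (W : zmodType) (T : nat -> nat -> nat -> nat -> W) L :
  \sum_(0 <= k < L) \sum_(0 <= i < L | (i + k < L)%N) \sum_(0 <= m < L)
    \sum_(0 <= r < L | (r + m + k < L)%N) T m k r i =
  \sum_(0 <= m < L) \sum_(0 <= k < L) \sum_(0 <= r < L)
    \sum_(0 <= i < L | (i + k < L)%N && (r + m + k < L)%N) T m k r i.
Proof.
rewrite [RHS]exchange_big_nat; apply: eq_bigr => k _ /=.
rewrite exchange_big_nat; apply: eq_bigr => m _ /=.
rewrite exchange_big_nat big_mkcond; apply: eq_bigr => r _ /=.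
by case: ifP => h; [apply: eq_bigl => i | rewrite big_pred0 // => i];
  rewrite ?andbT ?andbF.
Qed.

Lemma nested_index L M k b r : (r + M < L)%N -> (k <= M)%N -> (b < M.+1 - k)%N ->
  [/\ b + (M - k - b) = M - k, L - k - (M - k).+1 - r = L - M.+1 - r,
      L - k.+1 - (r + b) = M - k - b + (L - M.+1 - r)
    & b + k.+1 + (M - k - b) = M.+1]%N.
Proof. by split; lia. Qed.

(** [c] counts the letters between the two blocks and [t] those to the right of both. *)
Lemma disjoint_index L m k r i : (r < i)%N -> (i + m + k < L)%N ->
  exists c t, [/\ L = r + m.+1 + c + k.+1 + t, L - k - m.+1 - r = c + 1 + t,
      i + m = r + m.+1 + c & L - k.+1 - (i + m) = t]%N
  /\ [/\ L - m - k.+1 - i = t, L - m.+1 - r = c + k.+1 + t & i = r + 1 + c]%N.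
Proof.
by exists (i - r.+1)%N, (L - k.+1 - (i + m))%N; split; split; lia.
Qed.

(** * Expansion of a composite of two coderivations on a word *)

Section CoderComp.

Variables (K : fieldType) (V : lmodType K) (g : grading V).
Variable alpha : {linear V -> V}.

(** The range [N] may exceed the length [L], so that both factors of a composite, acting on words of
    different lengths, are summed over the same range. *)
Lemma coder_tens p (rho : forall m, {linear tensor_pow V m -> V}) w L N :
  size w = L -> (L <= N)%N ->
  coder g alpha p rho (tens w) =
    \sum_(0 <= m < N) \sum_(0 <= r < N | (r + m < L)%N)
      place g (iterlin alpha m) p r (L - m.+1 - r) (rho m.+1) (tens w).
Proof.
move=> sw LN; rewrite [LHS]tliftE /coder_word sw big_add1 /=.
rewrite (big_nat_widen _ _ _ _ _ LN) big_mkcond /=; apply: eq_bigr => m _.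
case: ltnP => mL; last first.
  rewrite big_pred0 // => r.
  by apply/negbTE; rewrite -leqNgt (leq_trans mL) ?leq_addl.
rewrite [LHS]tliftE /tilde_word sw subSS.
rewrite [LHS](@big_nat_widen _ _ _ _ _ N) ?(leq_trans (leq_subr _ _)) //=.
by apply: eq_bigl => r; rewrite ltn_subRL addnC.
Qed.

(* m and k are the arities of rho and sigma minus one. *)
Definition comp_term (p q : int)
    (rho sigma : forall m, {linear tensor_pow V m -> V})
    w m k r i : tensor_alg V :=
  place g (iterlin alpha m) p r (size w - k - m.+1 - r) (rho m.+1)
    (place g (iterlin alpha k) q i (size w - k.+1 - i) (sigma k.+1) (tens w)).

Lemma coder_comp_tens (p q : int)
    (rho sigma : forall m, {linear tensor_pow V m -> V}) w L :
  size w = L ->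
  coder g alpha p rho (coder g alpha q sigma (tens w)) =
    \sum_(0 <= m < L) \sum_(0 <= k < L)
      \sum_(0 <= r < L) \sum_(0 <= i < L | (i + k < L)%N && (r + m + k < L)%N)
        comp_term p q rho sigma w m k r i.
Proof.
move=> sw; rewrite (@coder_tens q _ _ L L) // linear_sum -sum_nat_reorder.
apply: eq_bigr => k _; rewrite linear_sum; apply: eq_bigr => i ikL.
rewrite /comp_term sw.
have [|w' sw' ->] := @place_size _ _ g (iterlin alpha k) q _ (sigma k.+1)
  i (L - k.+1 - i) w; first by lia.
(* The inner map turns [k + 1] letters into one, leaving [L - k] letters. *)
rewrite (@coder_tens p _ _ (L - k) L) ?leq_subr //; last by lia.
by apply: eq_bigr => m _; apply: eq_bigl => r; lia.
Qed.

(* The composition splits according to the position of the inner insertion: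
   to the right of the block of the outer one, to its left, or inside it. *)
Definition comp_right (p q : int)
    (rho sigma : forall m, {linear tensor_pow V m -> V}) w : tensor_alg V :=
  \sum_(0 <= m < size w) \sum_(0 <= k < size w) \sum_(0 <= r < size w)
    \sum_(0 <= i < size w | (r + m < i)%N && (i + k < size w)%N)
      comp_term p q rho sigma w m k r i.

Definition comp_left (p q : int)
    (rho sigma : forall m, {linear tensor_pow V m -> V}) w : tensor_alg V :=
  \sum_(0 <= m < size w) \sum_(0 <= k < size w) \sum_(0 <= i < size w)
    \sum_(0 <= r < size w | (i < r)%N && (r + m + k < size w)%N)
      comp_term p q rho sigma w m k r i.

(** [place_nested] identifies the terms and [sum_nat_nested] matches the index sets. *)
Lemma coder_brace_tens (p q : int)
    (rho sigma : forall m, {linear tensor_pow V m -> V}) w :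
  (forall i a, homog g i a -> homog g i (alpha a)) ->
  coder g alpha (p + q) (brace g alpha q rho sigma) (tens w) =
  \sum_(0 <= m < size w) \sum_(0 <= k < size w) \sum_(0 <= r < size w)
    \sum_(0 <= i < size w | (r <= i <= r + m)%N && (r + m + k < size w)%N)
      comp_term p q rho sigma w m k r i.
Proof.
move=> ha; set L := size w.
rewrite (@coder_tens _ _ _ L L) // -sum_nat_nested.
apply: eq_bigr => M _; apply: eq_bigr => r rML.
rewrite [LHS]tliftE /place_word.
have eL : size w = (r + M.+1 + (L - M.+1 - r))%N.
  by rewrite -subnDA [(M.+1 + r)%N]addnC subnKC // addnS.
have sMr : size (take M.+1 (drop r w)) = M.+1.
  by rewrite size_takel // size_drop eL -addnA addKn leq_addr.
rewrite {1}eL eqxx tens_atE [X in tens_at _ _ X](brace_tens _ _ _ _ _ sMr).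
rewrite linear_sum; apply: eq_big_nat => k /= kM; rewrite linear_sum.
apply: eq_big_nat => b /= bM; rewrite /comp_term /brace_word -/L.
have [e1 e2 e3 e4] := nested_index rML kM bM.
rewrite e2 e3 (place_nested ha _ _ _ _ e1) e4 //.
by rewrite subnK.
Qed.

(** Termwise this is [place_disjoint]; [comp_left] sums over [i] before [r] so that the index orders
    agree once the two maps are swapped. *)
Lemma comp_right_left (p q : int)
    (rho sigma : forall m, {linear tensor_pow V m -> V}) w :
  (forall i a, homog g i a -> homog g i (alpha a)) ->
  (forall m, (0 < m)%N -> has_degree g p (rho m) /\ equivariant alpha (rho m)) ->
  (forall m, (0 < m)%N -> equivariant alpha (sigma m)) ->
  comp_right p q rho sigma w = (-1) ^ (p * q) *: comp_left q p sigma rho w.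
Proof.
move=> ha hr hs; rewrite /comp_right /comp_left exchange_big_nat.
rewrite scaler_sumr; apply: eq_bigr => k _.
rewrite scaler_sumr; apply: eq_bigr => m _.
rewrite scaler_sumr; apply: eq_bigr => r _; rewrite scaler_sumr.
(* If [rho] acts first, its [m + 1] letters become one and the position of [sigma] drops by [m]. *)
rewrite (@sum_nat_shift _ _ _ m); last first.
  move=> i /andP[h1 h2]; rewrite (leq_trans (leq_addl _ _) (ltnW h1)).
  exact: leq_ltn_trans (leq_addr _ _) h2.
apply: eq_big => i; first by rewrite ltn_add2r addnAC.
case/andP; rewrite ltn_add2r => ri imk.
have [c [t [[e1 e2 e3 e4] [e5 e6 e7]]]] := disjoint_index ri imk.
have [hrho arho] := hr m.+1 isT.
rewrite /comp_term e2 e4 e3 e5 e6 e7.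
exact: (place_disjoint ha q hrho arho (hs k.+1 isT) e1).
Qed.

End CoderComp.

(** * Coderivations are closed under linear combinations and graded commutators *)

Section CoderLie.

Variables (K : fieldType) (V : lmodType K) (g : grading V).
Variable alpha : {linear V -> V}.

Lemma coder_comp_split (p q : int)
    (rho sigma : forall m, {linear tensor_pow V m -> V}) w :
  (forall i a, homog g i a -> homog g i (alpha a)) ->
  coder g alpha p rho (coder g alpha q sigma (tens w)) =
  coder g alpha (p + q) (brace g alpha q rho sigma) (tens w)
    + (comp_right g alpha p q rho sigma w + comp_left g alpha p q rho sigma w).
Proof.
move=> ha; rewrite (@coder_comp_tens _ _ _ _ _ _ _ _ _ (size w)) //.
by rewrite coder_brace_tens // sum_nat_split.
Qed.

Lemma place_lincomb f p r t m (rho sigma : {linear tensor_pow V m -> V}) c w :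
  c *: place g f p r t rho (tens w) + place g f p r t sigma (tens w) =
  place g f p r t (c \*: rho \+ sigma) (tens w).
Proof.
rewrite ![place _ _ _ _ _ _ _]tliftE /place_word.
case: ifP => _; last by rewrite scaler0 addr0.
by rewrite !tens_atE -linearP.
Qed.

Lemma Coder_linear p E : Coder g alpha p E -> linear E.
Proof. by case=> rho [_ eE] a x y; rewrite !eE linearP. Qed.

Lemma eq_Coder p E F : E =1 F -> Coder g alpha p E -> Coder g alpha p F.
Proof. by move=> eEF [rho [h eE]]; exists rho; split=> // x; rewrite -eEF. Qed.

Lemma Coder0 p : Coder g alpha p (fun=> 0).
Proof.
exists (fun m => \0); split=> [m _|].
  split=> [ds w _ _|x]; first by rewrite /homog linear0.
  by rewrite /= linear0.
apply: (@eq_tens _ _ _ \0) => w.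
rewrite (@coder_tens _ _ _ _ _ _ w _ (size w) erefl) //.
rewrite big1 // => m _; rewrite big1 // => r _.
rewrite [LHS]tliftE /place_word; case: ifP => // _.
by rewrite tens_atE linear0.
Qed.

Lemma Coder_lincomb p c E F : Coder g alpha p E -> Coder g alpha p F ->
  Coder g alpha p (fun x => c *: E x + F x).
Proof.
move=> [rho [hr eE]] [sigma [hs eF]].
pose tau m : {linear tensor_pow V m -> V} := (c \*: rho m) \+ sigma m.
exists tau; split=> [m m0|x].
  have [rd ra] := hr m m0; have [sd sa] := hs m m0; split=> [ds w sw hw|x].
    have /eqP := rd ds w sw hw; have /eqP := sd ds w sw hw.
    by rewrite /homog /= linearP => -> ->.
  by rewrite /= linearP ra sa.
rewrite eE eF; move: x.
pose G : {linear tensor_alg V -> tensor_alg V} :=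
  (c \*: coder g alpha p rho) \+ coder g alpha p sigma.
apply: (@eq_tens _ _ _ G) => w.
transitivity (c *: coder g alpha p rho (tens w)
  + coder g alpha p sigma (tens w)) => //.
rewrite !(@coder_tens _ _ _ _ _ _ w _ (size w) erefl) //.
rewrite scaler_sumr -big_split; apply: eq_bigr => m _.
rewrite scaler_sumr -big_split; apply: eq_bigr => r _.
exact: place_lincomb.
Qed.

Lemma Coder_sum p n (E : nat -> tensor_alg V -> tensor_alg V) :
  (forall i, (i < n)%N -> Coder g alpha p (E i)) ->
  Coder g alpha p (fun x => \sum_(i < n) E i x).
Proof.
elim: n => [|n IH] h.
  by apply: eq_Coder (Coder0 p) => x; rewrite big_ord0.
have h' := Coder_lincomb 1 (IH (fun i hi => h i (ltnW hi))) (h n (ltnSn n)).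
by apply: eq_Coder h' => x; rewrite scale1r big_ord_recr.
Qed.

Lemma Coder_brace (p q : int)
    (rho sigma : forall m, {linear tensor_pow V m -> V}) :
  (forall i a, homog g i a -> homog g i (alpha a)) ->
  (forall m, (0 < m)%N -> has_degree g p (rho m) /\ equivariant alpha (rho m)) ->
  (forall m, (0 < m)%N ->
    has_degree g q (sigma m) /\ equivariant alpha (sigma m)) ->
  Coder g alpha (p + q) (coder g alpha (p + q) (brace g alpha q rho sigma)).
Proof.
move=> ha hr hs; exists (fun M => brace g alpha q rho sigma (M:=M)).
split; last exact: frefl.
move=> m _; split.
  by apply: has_degree_brace => // k k0; [case: (hr k k0) | case: (hs k k0)].
by apply: equivariant_brace => // k k0; [case: (hr k k0) | case: (hs k k0)].
Qed.

Lemma Coder_bracket (p q : int) E F :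
  (forall i a, homog g i a -> homog g i (alpha a)) ->
  Coder g alpha p E -> Coder g alpha q F ->
  Coder g alpha (p + q) (fun x => E (F x) - (-1) ^ (p * q) *: F (E x)).
Proof.
move=> ha [rho [hr eE]] [sigma [hs eF]]; set s := (-1) ^ (p * q).
have hrs := Coder_brace ha hr hs; have hsr := Coder_brace ha hs hr.
rewrite (addrC q p) in hsr.
apply: eq_Coder (Coder_lincomb (- s) hsr hrs) => x; rewrite !eE !eF; move: x.
pose R := coder g alpha p rho; pose S := coder g alpha q sigma.
pose G1 : {linear tensor_alg V -> tensor_alg V} :=
  (- s \*: coder g alpha (p + q) (brace g alpha p sigma rho))
  \+ coder g alpha (p + q) (brace g alpha q rho sigma).
pose G2 : {linear tensor_alg V -> tensor_alg V} := (R \o S) \- (s \*: (S \o R)).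
apply: (@eq_tens _ _ _ G1 G2) => w.
transitivity (- s *: coder g alpha (p + q) (brace g alpha p sigma rho) (tens w)
  + coder g alpha (p + q) (brace g alpha q rho sigma) (tens w)) => //.
transitivity (R (S (tens w)) - s *: S (R (tens w))) => //; rewrite /R /S.
rewrite !coder_comp_split // (addrC q p).
(* Each right part is [s] times the left part of the opposite composite. Since [s * s = 1], all
   disjoint terms cancel and only the two braces remain. *)
rewrite (comp_right_left _ _ ha hr); last by move=> m m0; have [] := hs m m0.
rewrite (comp_right_left _ _ ha hs); last by move=> m m0; have [] := hr m m0.
rewrite (mulrC q p) -/s !scalerDr scalerA sign_int_sqr scale1r scaleNr.
rewrite (addrC (comp_left g alpha p q rho sigma w)) opprD.
by rewrite addrACA subrr addr0 addrC.
Qed.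

End CoderLie.

(** * The obstruction cocycle and the extension *)

(** The [Dt i] are bare functions whose linearity is only a proposition; the linear structure is
    packed locally. *)
Lemma linear_fun_sum (K : pzRingType) (U W : lmodType K) (f : U -> W) (s : seq nat)
    (P : pred nat) (F : nat -> U) :
  linear f -> f (\sum_(i <- s | P i) F i) = \sum_(i <- s | P i) f (F i).
Proof.
move=> hf; pose h := GRing.isLinear.Build K U W _ f hf.
pose f' : {linear U -> W} := HB.pack f h.
exact: (linear_sum f').
Qed.

(* By the equations of order at most n, both sides equal minus the sum of the
   D_i D_j D_k with i + j + k = n + 1 and i, k >= 1. *)
Lemma obstruction_comm (K : pzRingType) (W : lmodType K) (D : nat -> W -> W) n :
  (forall i, (i <= n)%N -> linear (D i)) ->
  (forall l, (l <= n)%N ->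
    forall x, \sum_(0 <= i < l.+1) D i (D (l - i)%N x) = 0) ->
  forall x, D 0 (\sum_(0 <= i < n) D i.+1 (D (n - i)%N x)) =
    \sum_(0 <= i < n) D i.+1 (D (n - i)%N (D 0 x)).
Proof.
move=> hD hS x.
have D0 i : (i <= n)%N -> D i 0 = 0.
  by move=> /hD h; have := h (-1) 0 0; rewrite scaler0 addr0 scaleN1r addNr.
pose C := \sum_(0 <= i < n) \sum_(0 <= j < n - i)
  D i.+1 (D (n - i - j.+1)%N (D j.+1 x)).
(* Apply D_(i+1) to the equation of order [n - i] and split off the term with D_0 innermost. *)
have eR : C + \sum_(0 <= i < n) D i.+1 (D (n - i)%N (D 0 x)) = 0.
  rewrite -big_split big_nat big1 // => i /= hi.
  rewrite big_nat_rev /= add0n.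
  have e : D i.+1 (\sum_(0 <= j < (n - i).+1) D j (D (n - i - j)%N x)) = 0.
    by rewrite hS ?leq_subr // D0.
  rewrite -[RHS]e linear_fun_sum; last exact: hD.
  rewrite big_nat_recr //= subnn; congr (_ + _).
  apply: eq_big_nat => j /= hj.
  by congr (D _ (D _ (D _ x))); lia.
(* Evaluate the equation of order [n - k] at D_(k+1) x and split off the term with D_0 outermost. *)
have eL : C + D 0 (\sum_(0 <= i < n) D i.+1 (D (n - i)%N x)) = 0.
  rewrite linear_fun_sum; last exact: hD.
  rewrite [X in _ + X]big_nat_rev /= add0n.
  have -> : C = \sum_(0 <= k < n) \sum_(0 <= i < n - k)
      D i.+1 (D (n - k - i.+1)%N (D k.+1 x)).
    transitivity (\sum_(0 <= i < n) \sum_(0 <= k < n | (i + k < n)%N)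
        D i.+1 (D (n - i - k.+1)%N (D k.+1 x))).
      apply: eq_big_nat => i /= hi; rewrite (big_nat_widen _ _ n) ?leq_subr //=.
      by apply: eq_bigl => j; rewrite ltn_subRL.
    rewrite (exchange_big_dep_nat xpredT) //=; apply: eq_big_nat => k /= hk.
    rewrite [RHS](big_nat_widen _ _ n) ?leq_subr //=.
    apply: eq_big => [j|i hi]; first by rewrite ltn_subRL addnC.
    by congr (D _ (D _ _)); lia.
  rewrite -big_split big_nat big1 // => k /= hk.
  have := hS (n - k)%N (leq_subr _ _) (D k.+1 x).
  rewrite big_nat_recl //= subn0 addrC => e0; rewrite -[RHS]e0; congr (_ + _).
  by congr (D 0 (D _ (D _ x))); lia.
by apply: (addrI C); rewrite eL eR.
Qed.

Theorem theorem6p9 (K : fieldType) (charK : [pchar K] =i pred0)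
    (X : HAinf K) (H3 : hochschild_vanishes X 3)
    (n : nat) (n_ge1 : (1 <= n)%N)
    (Dt : nat -> tensor_alg (ha_space X) -> tensor_alg (ha_space X))
    (hDt : deformation n Dt) :
  extends n Dt.
Proof.
have [hD0 hDi hS] := hDt.
(* Degree [i] in the shifted grading is degree [i - 1] in the original one, by conversion. *)
have alpha_degree i a : homog (shift (ha_grading X)) i a ->
    homog (shift (ha_grading X)) i (ha_alpha X a).
  exact: ha_alpha_degree.
have linD i : (i <= n)%N -> linear (Dt i).
  case: i => [_|i hi]; last exact: Coder_linear (hDi i.+1 hi).
  by move=> c x y; rewrite !hD0 /ha_D linearP.
(* The indices [i + 1] and [n - i] add up to [n + 1] and both lie between 1 and [n]. *)
pose Ob x := \sum_(0 <= i < n) Dt i.+1 (Dt (n - i)%N x).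
have ObE x : Ob x = \sum_(i < n) Dt i.+1 (Dt (n - i)%N x).
  by rewrite /Ob big_mkord.
have two_neq0 : (2%:R : K) != 0.
  by have := charK 2; rewrite !inE /= => /negbT.
have hOb : ha_Coder (X := X) (- (3 - 1)) Ob.
  (* Both degrees are odd, so each commutator is D_(i+1) D_(n-i) + D_(n-i) D_(i+1). Reversing the
     index in the second summand makes the total twice [Ob], and 2 is invertible. *)
  have hb : ha_Coder (X := X) (- (3 - 1)) (fun x => \sum_(i < n)
      (Dt i.+1 (Dt (n - i)%N x)
        - (-1) ^ (-1 * -1 : int) *: Dt (n - i)%N (Dt i.+1 x))).
    apply: (Coder_sum (E := fun i x => Dt i.+1 (Dt (n - i)%N x)
      - (-1) ^ (-1 * -1 : int) *: Dt (n - i)%N (Dt i.+1 x))) => i hi.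
    by apply: (@Coder_bracket _ _ _ _ (-1) (-1)) => //; apply: hDi; lia.
  apply: eq_Coder (Coder_lincomb (2%:R^-1) hb (Coder0 _ _ _)) => x.
  rewrite addr0; transitivity (2%:R^-1 *: (2%:R *: Ob x)); last first.
    by rewrite scalerA mulVf // scale1r.
  congr (_ *: _); rewrite ObE scaler_nat mulr2n.
  rewrite [X in _ = _ + X](reindex_inj rev_ord_inj) -big_split /=.
  apply: eq_bigr => i _; rewrite [_ ^ _](_ : _ = -1) // scaleN1r opprK.
  congr (_ + _).
  by have := ltn_ord i => hi; congr (Dt _ (Dt _ x)); lia.
have [|F hF eF] := H3 Ob.
  split=> // x; rewrite /delta /bracket.
  (* [Ob] has even degree, so its commutator with D is D Ob - Ob D. *)
  have sgn : (-1) ^ (-1 * - (3 - 1) : int) = 1 :> K.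
    by rewrite -[LHS]/((-1) ^+ 2) sqrrN expr1n.
  rewrite sgn scale1r -!hD0; apply/eqP; rewrite subr_eq0; apply/eqP.
  apply: obstruction_comm => // l hl y; rewrite big_mkord; exact: hS.
(* This is - F, written in the shape produced by [Coder_lincomb]. *)
exists (fun x => -1 *: F x + 0); first exact: Coder_lincomb hF (Coder0 _ _ _).
split=> [x|i hi|l hl x] /=; first exact: hD0.
- case: eqP => [_|ni]; first exact: Coder_lincomb hF (Coder0 _ _ _).
  by apply: hDi; lia.
move: hl; rewrite leq_eqVlt => /orP[/eqP -> | hl]; last first.
  rewrite -[RHS](hS l hl x); apply: eq_bigr => i _.
  have hi := ltn_ord i.
  by rewrite !ifF //; apply/negbTE; lia.
(* In order [n + 1] the first and last terms are - D F and - F D, and the middle ones form [Ob]. As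
   F has odd degree, [Ob] = [D, F] = D F + F D, and the sum vanishes. *)
rewrite big_ord_recl big_ord_recr /= subn0 !eqxx subnn.
rewrite [X in _ + (X + _)](_ : _ = Ob x); last first.
  rewrite ObE; apply: eq_bigr => i _; have hi := ltn_ord i.
  by rewrite /bump leq0n add1n subSS !ifF //; apply/negbTE; lia.
rewrite !addr0 !scaleN1r eF /delta /bracket hD0.
have -> : (-1) ^ (-1 * - (3 - 1 - 1) : int) = -1 :> K.
  by rewrite -[LHS]/((-1) ^+ 1).
rewrite [X in _ - F X]hD0.
by rewrite {1}/ha_D linearN scaleN1r opprK addrK addNr.
Qed.
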